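(* Let $d$ be a positive integer, let $\{\mathbb{P}_n\}_{n\ge 0}$ and $\{\mathbb{Q}_n\}_{n\ge 0}$ be two monic orthogonal polynomial systems in $d$ variables, and let $u$ and $v$ be their respective quasi-definite moment functionals (that is, $\{\mathbb{P}_n\}_{n\ge0}$ is orthogonal with respect to $u$ and $\{\mathbb{Q}_n\}_{n\ge0}$ is orthogonal with respect to $v$). Then the following conditions are equivalent: (i) There exist real matrices $M_n$ of size $r_n^d\times r_{n-1}^d$, $n\ge 1$, with $M_1\neq 0$, such that $$\mathbb{Q}_n=\mathbb{P}_n+M_n\,\mathbb{P}_{n-1},\qquad n\ge 1.$$ (ii) There exists a polynomial $\lambda(\mathtt{x})\in\Pi^d$ of degree one such that $$u=\lambda(\mathtt{x})\,v,$$ and $\mathbb{P}_1\neq\mathbb{Q}_1$.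
   Context: $\Pi^d$ is the space of real polynomials in $d$ variables $\mathtt{x}=(x_1,\dots,x_d)$, and $\Pi^d_n$ its subspace of polynomials of total degree at most $n$ (with $\Pi^d_{-1}=\{0\}$). $r_n^d=\binom{n+d-1}{d-1}$ is the number of monomials of total degree $n$. $\mathbb{X}_n$ is the column vector of all monomials $\mathtt{x}^\alpha$, $|\alpha|=n$, arranged in reverse lexicographical order (for $d=2$: $x_1^n,x_1^{n-1}x_2,\dots,x_2^n$). A polynomial system (PS) is a sequence $\{\mathbb{P}_n\}_{n\ge0}$ where $\mathbb{P}_n$ is a column vector of $r_n^d$ polynomials of total degree $n$ that are linearly independent modulo $\Pi^d_{n-1}$. It is monic if, for every $n\ge 0$, all entries of $\mathbb{P}_n-\mathbb{X}_n$ lie in $\Pi^d_{n-1}$ (in particular $\mathbb{P}_0=1$). A moment functional is a linear functional $u:\Pi^d\to\mathbb{R}$; it acts entrywise on matrices of polynomials. For $p\in\Pi^d$, the product $p\,u$ is the moment functional $\langle p\,u,q\rangle=\langle u,p\,q\rangle$, $q\in\Pi^d$. A PS $\{\mathbb{P}_n\}_{n\ge 0}$ is an orthogonal polynomial system (OPS) with respect to $u$ if $\langle u,\mathbb{P}_n\mathbb{P}_m^t\rangle=0$ for $n\ne m$ and $\langle u,\mathbb{P}_n\mathbb{P}_n^t\rangle=H_n$ is a (symmetric) non-singular matrix for all $n\ge 0$. A monic orthogonal polynomial system is a monic PS that is an OPS with respect to some moment functional. A moment functional $u$ is quasi-definite if there is a basis $B$ of $\Pi^d$ such that, for all $p,q\in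 B$, $\langle u,pq\rangle=0$ if $p\neq q$ and $\langle u,p^2\rangle\ne0$; equivalently, if there exists an OPS with respect to $u$. *)

(* Defs.v *)
From HB Require Import structures.
From mathcomp Require Export all_boot all_order all_algebra.
From mathcomp Require Export reals.
From mathcomp Require Export mpoly.

Set Implicit Arguments.
Unset Strict Implicit.
Unset Printing Implicit Defensive.

Import Order.TTheory GRing.Theory.

Local Open Scope ring_scope.

(* The subtractions are natural-number predecessors, so this is the intended
   number only for 0 < d. *)
Definition r (d n : nat) : nat := 'C(n + d.-1, d.-1).

Section Monomials.

(* The library's order <=%O on 'X_{1..d} compares total degrees first, then the
   exponent sequences lexicographically (see leEmnm; the header of mpoly
   calls it degrevlex). The list is decreasing for it: x_1^n comes first and
   x_d^n last. *)
Definition monomials (d n : nat) : seq 'X_{1..d} :=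
  sort (fun m1 m2 => m2 <= m1)%O
    [seq val m | m <- enum [pred m : 'X_{1..d < n.+1} | mdeg m == n]].

Lemma mem_monomials d n (m : 'X_{1..d}) : (m \in monomials d n) = (mdeg m == n).
Proof.
rewrite mem_sort; apply/mapP/idP => [[m' + ->]|/eqP mdeg_m].
  by rewrite mem_enum inE.
have lt_m : (mdeg m < n.+1)%N by rewrite mdeg_m.
by exists (BMultinom lt_m); rewrite // mem_enum inE /= mdeg_m.
Qed.

Lemma monomials_uniq d n : uniq (monomials d n).
Proof. by rewrite sort_uniq (map_inj_uniq val_inj) enum_uniq. Qed.

Lemma size_monomials d n : (0 < d)%N -> size (monomials d n) = r d n.
Proof.
case: d => // d _; rewrite /r /= -bin_sub ?leq_addl // addnK.
rewrite -size_basis; apply/perm_size/uniq_perm => [||m].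
- exact: monomials_uniq.
- exact: uniq_basis.
- by rewrite mem_monomials basis_cover.
Qed.

End Monomials.

Section OrthogonalPolynomials.

Context {R : realType} {d : nat}.

Local Notation Pi := {mpoly R[d]}.

(* [msize p] is the total degree of p plus one, and 0 for p = 0. Hence
   [deg_lt n] is the space of polynomials of total degree at most n - 1,
   which is {0} for n = 0. *)
Definition deg_lt (n : nat) (p : Pi) : Prop := (msize p <= n)%N.

Definition has_deg (n : nat) (p : Pi) : Prop := msize p = n.+1.

(* The default of nth is never reached when 0 < d, by size_monomials. *)
Definition Xvec (n : nat) : 'cV[Pi]_(r d n) :=
  \col_i 'X_[nth 0%MM (monomials d n) i].

Definition mxC {m n : nat} (A : 'M[R]_(m, n)) : 'M[Pi]_(m, n) :=
  map_mx (@mpolyC d R) A.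

Definition polyvecs : Type := forall n : nat, 'cV[Pi]_(r d n).

Definition free_mod_lt (n : nat) {k : nat} (p : 'cV[Pi]_k) : Prop :=
  forall c : 'I_k -> R, deg_lt n (\sum_i c i *: p i 0) -> forall i, c i = 0.

Definition polynomial_system (P : polyvecs) : Prop :=
  forall n, (forall i, has_deg n (P n i 0)) /\ free_mod_lt n (P n).

Definition monic_system (P : polyvecs) : Prop :=
  forall n i, deg_lt n ((P n - Xvec n) i 0).

Definition functional : Type := {scalar Pi}.

Definition mul_functional (p : Pi) (u : functional) (q : Pi) : R := u (p * q).

Lemma mul_functional_is_linear (p : Pi) (u : functional) :
  scalar (mul_functional p u).
Proof. by move=> a q1 q2; rewrite /mul_functional mulrDr -scalerAr linearP. Qed.

HB.instance Definition _ (p : Pi) (u : functional) :=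
  GRing.isLinear.Build R Pi R *%R (mul_functional p u)
    (mul_functional_is_linear p u).

Definition act {m n : nat} (u : functional) (A : 'M[Pi]_(m, n)) : 'M[R]_(m, n) :=
  map_mx u A.

Definition OPS (u : functional) (P : polyvecs) : Prop :=
  [/\ polynomial_system P,
      forall n m, n <> m -> act u (P n *m (P m)^T) = 0
    & forall n, act u (P n *m (P n)^T) \in unitmx].

Definition is_basis (B : Pi -> Prop) : Prop :=
  (forall (s : seq Pi) (c : Pi -> R), uniq s -> (forall b, b \in s -> B b) ->
     \sum_(b <- s) c b *: b = 0 -> forall b, b \in s -> c b = 0)
  /\
  (forall p : Pi, exists (s : seq Pi) (c : Pi -> R),
     (forall b, b \in s -> B b) /\ p = \sum_(b <- s) c b *: b).

Definition quasi_definite (u : functional) : Prop :=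
  exists B : Pi -> Prop, is_basis B /\
    (forall p q, B p -> B q -> p <> q -> u (p * q) = 0) /\
    (forall p, B p -> u (p * p) <> 0).

End OrthogonalPolynomials.

Arguments polyvecs : clear implicits.
Arguments functional : clear implicits.

(* Main.v *)
Require Import Defs.

(** A relation with two terms on the polynomial side is dual to a multiplier of
    degree one on the functional side; the two conditions are translated into
    each other by testing functionals against the two systems.

    A monic system is a basis of the whole space, graded by degree, so a
    functional is known from its values on the entries of the system
    ([eq_functional_monic]), and [OPS v Q] makes [Q n] orthogonal, with respect
    to [v], to every polynomial of degree less than [n] ([OPS_deg_lt]).

    From the matrices to the factor: [u] kills the entries of [P k] for
    [k >= 1], hence, by the relation, those of [Q k] for [k >= 2]. Since the
    Gram matrices of [Q] are invertible, some combination [lambda] of the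
    entries of [Q 0] and [Q 1] has prescribed pairings with [Q 0] and [Q 1]
    under [v]; then [lambda v] and [u] agree on all of [Q]
    ([functional_density]). Were [lambda] constant, [u] would kill
    [Q 1 *m (P 0)^T], which by the relation has the value [M 1 *m H], with [H]
    the invertible Gram matrix of [P 0].

    From the factor to the matrices: the coefficient of [P k] in the expansion
    of [Q n] is determined by
    [act u (Q n *m (P k)^T) = act v (Q n *m (lambda *: P k)^T)], and this is
    zero when [k + 1 < n], so that only [P n.-1] and [P n] occur, the latter
    with the identity as coefficient because both systems are monic. In place
    of the expansion, the proof shows that [Q n - P n - M n *m P n.-1] has
    degree less than [n] and is orthogonal to all [P k] with [k < n], which
    forces it to vanish ([OPS_nondegenerate]).

    The clauses [M 1 <> 0] and [P 1 <> Q 1] match because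
    [Q 1 - P 1 = M 1 *m P 0] and the entries of [P 0] are linearly
    independent. *)

Set Implicit Arguments.
Unset Strict Implicit.
Unset Printing Implicit Defensive.

Import GRing.Theory.

Local Open Scope ring_scope.

(** * Polynomials of bounded total degree *)

Section TotalDegree.

Context {R : realType} {d : nat}.
Implicit Types p q : {mpoly R[d]}.

Lemma deg_ltP n p :
  deg_lt n p <-> forall m : 'X_{1..d}, (n <= mdeg m)%N -> p@_m = 0.
Proof.
rewrite /deg_lt; split=> [le_p m le_m | p0].
  by apply: memN_msupp_eq0; apply: msize_mdeg_ge; apply: leq_trans le_m.
rewrite msizeE big_seq; elim/big_ind: _ => // [x y ? ?|m m_p].
  by rewrite geq_max; apply/andP.
rewrite ltnNge; apply: contraL m_p => le_m.
by rewrite -mcoeff_eq0 p0.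
Qed.

Lemma deg_ltW m n p : (m <= n)%N -> deg_lt m p -> deg_lt n p.
Proof. by move=> le_mn le_p; apply: leq_trans le_mn. Qed.

Lemma deg_lt_sum n (I : finType) (A : {pred I}) (F : I -> {mpoly R[d]}) :
  (forall i, i \in A -> deg_lt n (F i)) -> deg_lt n (\sum_(i in A) F i).
Proof.
move=> F_lt; apply/deg_ltP => m le_m; rewrite raddf_sum big1 // => i Ai.
by move/deg_ltP: (F_lt i Ai); apply.
Qed.

Lemma deg_ltB n p q : deg_lt n p -> deg_lt n q -> deg_lt n (p - q).
Proof.
move=> /deg_ltP p_lt /deg_ltP q_lt; apply/deg_ltP => m le_m.
by rewrite mcoeffB p_lt // q_lt // subr0.
Qed.

Lemma deg_ltZ n (c : R) p : deg_lt n p -> deg_lt n (c *: p).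
Proof. exact/leq_trans/msizeZ_le. Qed.

Lemma deg_ltM m n p q :
  deg_lt m.+1 p -> deg_lt n q -> deg_lt (m + n)%N (p * q).
Proof.
rewrite /deg_lt => p_lt q_lt.
have [->|p0] := eqVneq p 0; first by rewrite mul0r msize0.
have [->|q0] := eqVneq q 0; first by rewrite mulr0 msize0.
rewrite msizeM // -ltnS prednK -?addSn ?leq_add //.
by rewrite addn_gt0 lt0n msize_poly_eq0 p0.
Qed.

End TotalDegree.

(** * Functionals acting on matrices of polynomials *)

Section Action.

Context {R : realType} {d : nat}.
Implicit Types u v : functional R d.

Lemma mulmx_mxC m n (A : 'M[R]_(m, n)) (B : 'cV[{mpoly R[d]}]_n) i :
  (mxC A *m B) i 0 = \sum_j A i j *: B j 0.
Proof. by rewrite mxE; apply: eq_bigr => j _; rewrite mxE mul_mpolyC. Qed.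

Lemma actD u m n (A B : 'M[{mpoly R[d]}]_(m, n)) :
  act u (A + B) = act u A + act u B.
Proof. exact: map_mxD. Qed.

Lemma actB u m n (A B : 'M[{mpoly R[d]}]_(m, n)) :
  act u (A - B) = act u A - act u B.
Proof. exact: map_mxB. Qed.

Lemma act_mulmx_mxC u m n k (A : 'M[R]_(m, n)) (B : 'M[{mpoly R[d]}]_(n, k)) :
  act u (mxC A *m B) = A *m act u B.
Proof.
apply/matrixP => i j; rewrite !mxE linear_sum; apply: eq_bigr => l _.
by rewrite !mxE mul_mpolyC linearZ.
Qed.

Lemma act_outerE u m n (A : 'cV[{mpoly R[d]}]_m) (B : 'cV[{mpoly R[d]}]_n) i j :
  act u (A *m B^T) i j = u (A i 0 * B j 0).
Proof. by rewrite mxE mxE big_ord1 mxE. Qed.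

End Action.

(** * Expansion and orthogonality in a monic system *)

Section MonicSystem.

Context {R : realType} {d : nat}.
Hypothesis d_gt0 : (0 < d)%N.
Variable P : polyvecs R d.
Hypothesis P_monic : monic_system P.
Implicit Types (p q : {mpoly R[d]}) (f g u : functional R d).

Lemma monic_deg_lt n i : deg_lt n.+1 (P n i 0).
Proof.
apply/deg_ltP => m lt_m; have /deg_ltP/(_ m (ltnW lt_m)) := P_monic i.
rewrite !mxE mcoeffB mcoeffX => /eqP; rewrite subr_eq0 => /eqP ->.
case: eqP => // nth_m; move: lt_m; have := mem_monomials n m.
by rewrite -nth_m mem_nth ?size_monomials // => /esym/eqP ->; rewrite ltnn.
Qed.

(** The coefficients are those of [p] at the monomials of degree [n]: the
    entries of [P n] and of the vector of monomials have the same top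
    homogeneous part. *)
Lemma monic_reduce n p : deg_lt n.+1 p ->
  exists c : 'rV[R]_(r d n), deg_lt n (p - (mxC c *m P n) 0 0).
Proof.
move=> /deg_ltP p_lt; pose mon := nth 0%MM (monomials d n).
exists (\row_i p@_(mon i)); apply/deg_ltP => m le_m.
rewrite mcoeffB mulmx_mxC raddf_sum /=.
have PE i : (P n i 0)@_m = (mon i == m)%:R.
  have /deg_ltP/(_ m le_m) := P_monic i.
  by rewrite !mxE mcoeffB mcoeffX => /eqP; rewrite subr_eq0 => /eqP.
under eq_bigr => i _ do rewrite mcoeffZ PE mxE.
have [m_n | m_n] := boolP (m \in monomials d n).
  have lt_i : (index m (monomials d n) < r d n)%N.
    by rewrite -size_monomials // index_mem.
  have mon_i : mon (Ordinal lt_i) = m by rewrite /mon nth_index.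
  rewrite (bigD1 (Ordinal lt_i)) //= mon_i eqxx mulr1 big1 ?addr0 ?subrr //.
  move=> j j_neq; case: eqP => [mon_j|]; last by rewrite mulr0.
  case/eqP: j_neq; apply/val_inj; rewrite /= -mon_j index_uniq //.
    by rewrite size_monomials.
  exact: monomials_uniq.
rewrite p_lt ?sub0r; last first.
  by rewrite ltn_neqAle le_m andbT eq_sym -mem_monomials.
rewrite big1 ?oppr0 // => i _; case: eqP => [mon_i|]; last by rewrite mulr0.
by case/negP: m_n; rewrite -mon_i mem_nth ?size_monomials.
Qed.

(** The entries of [P k] with [k < n] span the polynomials of degree less
    than [n]. *)
Lemma eq_functional_deg_lt f g n :
  (forall k, (k < n)%N -> forall i, f (P k i 0) = g (P k i 0)) ->
  forall p, deg_lt n p -> f p = g p.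
Proof.
elim: n => [_ p|n IHn fg p p_lt].
  by rewrite /deg_lt leqn0 msize_poly_eq0 => /eqP ->; rewrite !linear0.
have [c /IHn] := monic_reduce p_lt.
rewrite !linearB /= => /(_ (fun k lt_k => fg k (ltnW lt_k))).
suff -> : f ((mxC c *m P n) 0 0) = g ((mxC c *m P n) 0 0) by apply: addIr.
rewrite mulmx_mxC !linear_sum; apply: eq_bigr => i _.
by rewrite !linearZ /= fg.
Qed.

Lemma eq_functional_monic f g :
  (forall k i, f (P k i 0) = g (P k i 0)) -> f =1 g.
Proof.
by move=> fg p; apply: (@eq_functional_deg_lt f g (msize p)) (leqnn _) => k _.
Qed.

Section Orthogonal.

Variable u : functional R d.
Hypothesis P_ops : OPS u P.

Lemma OPS_neq n m i j : n <> m -> u (P n i 0 * P m j 0) = 0.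
Proof.
by case: P_ops => _ orth _ /orth/matrixP/(_ i j); rewrite act_outerE !mxE.
Qed.

Lemma OPS_deg_lt n p i : deg_lt n p -> u (P n i 0 * p) = 0.
Proof.
move=> p_lt.
apply: (@eq_functional_deg_lt (mul_functional (P n i 0) u) \0 n) p_lt.
move=> k k_n j.
rewrite /= /mul_functional OPS_neq // => n_k.
by rewrite n_k ltnn in k_n.
Qed.

(** Pairing [p] with [P n] reads off the top coefficients of [p], through the
    invertible Gram matrix of [P n]; so the degree of [p] drops step by step. *)
Lemma OPS_nondegenerate n p : deg_lt n p ->
  (forall k, (k < n)%N -> forall j, u (p * P k j 0) = 0) -> p = 0.
Proof.
elim: n p => [|n IHn] p p_lt p_orth.
  by apply/eqP; rewrite -msize_poly_eq0 -leqn0.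
apply: IHn => [|k /ltnW]; last exact: p_orth.
have [c pc_lt] := monic_reduce p_lt.
suff c0 : c = 0 by move: pc_lt; rewrite c0 /mxC map_mx0 mul0mx mxE subr0.
have [_ _ /(_ n) H_unit] := P_ops.
rewrite -[c](mulmxK H_unit) -act_mulmx_mxC mulmxA.
suff -> : act u (mxC c *m P n *m (P n)^T) = 0 by rewrite mul0mx.
apply/rowP => j; rewrite act_outerE [RHS]mxE.
have := OPS_deg_lt j pc_lt.
rewrite mulrC mulrBl linearB /= p_orth // sub0r => /eqP.
by rewrite oppr_eq0 => /eqP.
Qed.

(** Within each degree [k], the inverse of the Gram matrix of [P k] turns the
    values of [f] on [P k] into the coefficients of a multiplier, and by
    orthogonality the degrees do not interfere. Only the degrees below [n]
    contribute, so the multiplier is a polynomial. *)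
Lemma functional_density n f :
  (forall k, (n <= k)%N -> forall i, f (P k i 0) = 0) ->
  exists2 p, deg_lt n p & f =1 mul_functional p u.
Proof.
move=> f0; have [_ orth H_unit] := P_ops.
pose w k : 'rV[R]_(r d k) :=
  (act f (P k))^T *m invmx (act u (P k *m (P k)^T)).
pose part k := (mxC (w k) *m P k) 0 0.
have part_lt k : deg_lt k.+1 (part k).
  rewrite /part mulmx_mxC; apply: deg_lt_sum => i _; apply: deg_ltZ.
  exact: monic_deg_lt.
exists (\sum_(k < n) part k).
  by apply: deg_lt_sum => k _; apply: deg_ltW (part_lt k); apply: ltn_ord.
have partE k m j : u (part k * P m j 0) = if k == m then f (P m j 0) else 0.
  rewrite -(act_outerE u (mxC (w k) *m P k)) -mulmxA act_mulmx_mxC.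
  move: j; have [<- j|/eqP km j] := eqVneq k m.
    by rewrite mulmxKV // !mxE.
  by rewrite orth // mulmx0 mxE.
apply: eq_functional_monic => m j.
rewrite /= /mul_functional mulr_suml linear_sum.
under eq_bigr => k _ do rewrite /= partE.
have [lt_m|le_m] := ltnP m n.
  rewrite (bigD1 (Ordinal lt_m)) //= eqxx big1 ?addr0 // => k.
  by rewrite -val_eqE /= => /negPf ->.
by rewrite f0 // big1 // => k _; case: eqP.
Qed.

End Orthogonal.

End MonicSystem.

(** * Comparison of two orthogonal systems *)

Section TwoSystems.

Context {R : realType} {d : nat}.
Hypothesis d_gt0 : (0 < d)%N.
Variables (P Q : polyvecs R d) (u v : functional R d).
Hypotheses (P_monic : monic_system P) (P_ops : OPS u P).
Hypotheses (Q_monic : monic_system Q) (Q_ops : OPS v Q).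

Let PQ_related :=
  exists M : forall n : nat, 'M[R]_(r d n, r d n.-1),
    M 1%N <> 0 /\
    forall n : nat, (1 <= n)%N -> Q n = P n + mxC (M n) *m P n.-1.

Lemma related_neq : PQ_related -> P 1%N <> Q 1%N.
Proof.
case=> M [M1_neq0 QE] PQ; apply: M1_neq0; apply/matrixP => i j; rewrite mxE.
have [P_ps _ _] := P_ops; have [_ P0_free] := P_ps 0%N.
apply: (P0_free (M 1%N i)); rewrite -mulmx_mxC.
have /esym/eqP := QE 1%N isT.
rewrite -PQ -subr_eq0 addrC addKr => /eqP ->.
by rewrite mxE /deg_lt msize0.
Qed.

Lemma related_density :
  PQ_related ->
  exists lambda, has_deg 1 lambda /\ u =1 mul_functional lambda v.
Proof.
case=> M [M1_neq0 QE].
have uP k i : (0 < k)%N -> u (P k i 0) = 0.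
  move=> k_gt0; rewrite -[P k i 0]mulr1.
  by apply: (OPS_deg_lt d_gt0 P_monic P_ops); rewrite /deg_lt msize1.
have uQ k : (1 < k)%N -> forall i, u (Q k i 0) = 0.
  move=> k_gt1 i; rewrite QE ?(ltnW k_gt1) // mxE linearD /=.
  rewrite uP ?(ltnW k_gt1) // mulmx_mxC linear_sum big1 ?addr0 // => j _.
  by rewrite linearZ /= uP ?mulr0 // -ltnS prednK // ltnW.
have [lambda lambda_lt uE] := functional_density d_gt0 Q_monic Q_ops uQ.
exists lambda; split=> //; apply/eqP; rewrite eqn_leq [X in X && _]lambda_lt.
(* For a constant lambda, the entries of lambda *: P 0 are still constant,
   hence orthogonal to Q 1 with respect to v; this forces M 1 = 0. *)
rewrite ltnNge; apply/negP => lambda_const; apply: M1_neq0.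
have [_ P_orth /(_ 0%N) H_unit] := P_ops.
rewrite -[M 1%N](mulmxK H_unit) -act_mulmx_mxC mulmxA.
suff -> : act u (mxC (M 1%N) *m P 0%N *m (P 0%N)^T) = 0 by rewrite mul0mx.
transitivity (act u (Q 1%N *m (P 0%N)^T)).
  by rewrite QE // mulmxDl actD P_orth // add0r.
apply/matrixP => i j; rewrite act_outerE uE /mul_functional mulrCA [RHS]mxE.
apply: (OPS_deg_lt d_gt0 Q_monic Q_ops).
exact: (@deg_ltM _ _ 0 1 _ _ lambda_const (monic_deg_lt d_gt0 P_monic _)).
Qed.

Lemma density_related lambda :
  has_deg 1 lambda -> u =1 mul_functional lambda v -> P 1%N <> Q 1%N ->
  PQ_related.
Proof.
move=> lambda_deg uE PQ_neq; have [_ P_orth H_unit] := P_ops.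
have QP_orth n k : (k.+1 < n)%N -> act u (Q n *m (P k)^T) = 0.
  move=> lt_k; apply/matrixP => i j.
  rewrite act_outerE uE /mul_functional mulrCA [RHS]mxE.
  apply: (OPS_deg_lt d_gt0 Q_monic Q_ops); apply: deg_ltW lt_k _.
  apply: (@deg_ltM _ _ 1 k.+1); last exact: monic_deg_lt.
  by rewrite /deg_lt lambda_deg.
pose M n : 'M[R]_(r d n, r d n.-1) :=
  act u (Q n *m (P n.-1)^T) *m invmx (act u (P n.-1 *m (P n.-1)^T)).
have QE n : (1 <= n)%N -> Q n = P n + mxC (M n) *m P n.-1.
  case: n => // n _; apply/eqP; rewrite -subr_eq0 opprD addrA; apply/eqP.
  apply/colP => i; rewrite [RHS]mxE.
  apply: (OPS_nondegenerate d_gt0 P_monic P_ops (n := n.+1)) => [|k lt_k j].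
    (* The leading vectors of monomials of Q and P cancel. *)
    have -> : Q n.+1 - P n.+1 = (Q n.+1 - Xvec n.+1) - (P n.+1 - Xvec n.+1).
      by rewrite opprB addrA subrK.
    rewrite mxE mxE [X in _ + X]mxE [X in _ + X + _]mxE.
    apply: deg_ltB; first by apply: deg_ltB; [apply: Q_monic|apply: P_monic].
    rewrite mulmx_mxC; apply: deg_lt_sum => l _.
    by apply: deg_ltZ; apply: monic_deg_lt.
  rewrite -act_outerE !mulmxBl !actB -mulmxA act_mulmx_mxC.
  rewrite (P_orth n.+1 k) ?subr0; last by move=> nk; rewrite nk ltnn in lt_k.
  move: j; have [-> j|k_n j] := eqVneq k n.
    by rewrite mulmxKV // subrr mxE.
  rewrite QP_orth ?P_orth ?mulmx0 ?subr0 ?mxE //.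
    by apply/eqP; rewrite eq_sym.
  by rewrite ltnS ltn_neqAle k_n.
exists M; split=> // M1_0; apply: PQ_neq.
by rewrite QE // M1_0 /mxC map_mx0 mul0mx addr0.
Qed.

End TwoSystems.

Theorem theorem2 (R : realType) (d : nat) (d_gt0 : (0 < d)%N)
    (P Q : polyvecs R d) (u v : functional R d)
    (u_qd : quasi_definite u) (v_qd : quasi_definite v)
    (P_monic : monic_system P) (P_ops : OPS u P)
    (Q_monic : monic_system Q) (Q_ops : OPS v Q) :
  (exists M : forall n : nat, 'M[R]_(r d n, r d n.-1),
     M 1%N <> 0 /\
     forall n : nat, (1 <= n)%N -> Q n = P n + mxC (M n) *m P n.-1)
  <->
  ((exists lambda : {mpoly R[d]},
      has_deg 1 lambda /\ u =1 mul_functional lambda v) /\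
   P 1%N <> Q 1%N).
Proof.
split=> [PQ | [[lambda [lambda_deg uE]] PQ_neq]].
  split; last exact: (related_neq P_ops PQ).
  exact: (related_density d_gt0 P_monic P_ops Q_monic Q_ops PQ).
apply: (density_related d_gt0 P_monic P_ops Q_monic Q_ops) PQ_neq => //.
exact: lambda_deg.
Qed.
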